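(* Let $A\in\mathcal{B}(\mathcal{H})$ be a positive operator with $\dim(R(A))\ge 2$, let $q\in\mathcal{D}$ and let $T\in\mathcal{B}_{A^{1/2}}(\mathcal{H})$. Then $W_{q,A}(T)\subseteq W_q(\widetilde{T})$.
   Context: $\mathcal{H}$ is a separable infinite-dimensional complex Hilbert space with inner product $\langle\cdot,\cdot\rangle$ (linear in the first variable); $\mathcal{B}(\mathcal{H})$ is the algebra of bounded linear operators on $\mathcal{H}$; $R(A)$ is the range of $A$ and $P_{\overline{R(A)}}$ the orthogonal projection onto $\overline{R(A)}$. $A$ positive means $\langle Ax,x\rangle\ge 0$ for all $x$. Put $\langle x,y\rangle_A=\langle Ax,y\rangle$ and $\|x\|_A=\sqrt{\langle x,x\rangle_A}$. $\mathcal{D}=\{z\in\mathbb{C}:|z|\le 1\}$. $\mathcal{B}_{A^{1/2}}(\mathcal{H})=\{T\in\mathcal{B}(\mathcal{H}):\exists c>0,\ \|Tx\|_A\le c\|x\|_A\ \forall x\in\mathcal{H}\}$. The $A$-$q$-numerical range is $W_{q,A}(T)=\{\langle Tx,y\rangle_A: x,y\in\mathcal{H},\ \|x\|_A=\|y\|_A=1,\ \langle x,y\rangle_A=q\}$. $\mathbf{R}(A^{1/2})$ denotes the Hilbert space $R(A^{1/2})$ with inner product $(A^{1/2}x,A^{1/2}y)=\langle P_{\overline{R(A)}}x,P_{\overline{R(A)}}y\rangle$, $x,y\in\mathcal{H}$. Let $Z_A:\mathcal{H}\to\mathbf{R}(A^{1/2})$, $Z_Ax=Ax$. For $T\in\mathcal{B}_{A^{1/2}}(\mathcal{H})$,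 $\widetilde{T}$ denotes the unique operator in $\mathcal{B}(\mathbf{R}(A^{1/2}))$ with $Z_AT=\widetilde{T}Z_A$ (its existence and uniqueness are known). For a bounded operator $S$ on a complex Hilbert space $\mathcal{K}$ with inner product $(\cdot,\cdot)$, the $q$-numerical range is $W_q(S)=\{(Su,v):u,v\in\mathcal{K},\ \|u\|=\|v\|=1,\ (u,v)=q\}$. *)

(* Defs.v *)
From HB Require Import structures.
From mathcomp Require Import all_boot all_order all_algebra.
From mathcomp Require Import sesquilinear complex.
From mathcomp Require Import all_classical all_reals all_analysis.
From mathcomp Require Import ring lra.

Set Implicit Arguments.
Unset Strict Implicit.
Unset Printing Implicit Defensive.

Import Order.TTheory GRing.Theory Num.Theory.
Import numFieldNormedType.Exports.

Local Open Scope classical_set_scope.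
Local Open Scope complex_scope.
Local Open Scope ring_scope.

(* The form is linear in its first argument, conjugate-linear in the second. *)
HB.mixin Record CompleteNormedModule_isHilbert (R : realType) H
    of CompleteNormedModule R[i] H := {
  inner : {dot H for Num.conj};
  normr_inner : forall x : H, `|x| = sqrtC (inner x x)
}.

#[short(type="hilbertType")]
HB.structure Definition Hilbert (R : realType) :=
  {H of CompleteNormedModule_isHilbert R H & CompleteNormedModule R[i] H}.

Notation "'[ x , y ]" := (inner x y) : ring_scope.

(* B(K): everywhere defined bounded linear operators on K. *)
Record bop (R : realType) (K : hilbertType R) := Bop {
  bop_fun :> {linear K -> K};
  bop_bounded : exists c : R, forall x : K, `|bop_fun x| <= c%:C * `|x|
}.

Definition positive_op (R : realType) (K : hilbertType R) (A : bop K) :=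
  forall x : K, 0 <= '[A x, x].

Section HilbertTheory.
Variables (R : realType) (H : hilbertType R).
Implicit Types x y z : H.

Lemma sqr_normr_inner x : `|x| ^+ 2 = '[x, x].
Proof. by rewrite normr_inner sqrtCK. Qed.

Lemma inner_conj x y : '[x, y] = ('[y, x])^*%R.
Proof. by rewrite hermC expr0 mul1r. Qed.

Lemma parallelogram x y :
  `|x + y| ^+ 2 + `|x - y| ^+ 2 = 2 * `|x| ^+ 2 + 2 * `|y| ^+ 2.
Proof.
rewrite !sqr_normr_inner !(linearDl, linearDr, linearNl, linearNr) /=.
ring.
Qed.

Lemma inner_eq0P x : (forall y, '[x, y] = 0) -> x = 0.
Proof. by move=> /(_ x)/eqP; rewrite dnorm_eq0 => /eqP. Qed.

Definition rnorm x : R := complex.Re `|x|.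

Lemma rnormE x : `|x| = (rnorm x)%:C.
Proof. by rewrite /rnorm RRe_real// ger0_real. Qed.

End HilbertTheory.

Definition is_subspace (R : realType) (H : hilbertType R) (M : set H) :=
  M 0 /\ forall (a : R[i]) (x y : H), M x -> M y -> M (a *: x + y).

(* The orthogonal projection onto M, characterized by [M y] and [x - y] being
   orthogonal to M; [orth_projP] shows that such a point exists for every closed
   subspace M, so that the default 0 is then never used. *)
Definition orth_proj (R : realType) (H : hilbertType R) (M : set H) (x : H) : H :=
  xget 0 [set y | M y /\ forall z, M z -> '[x - y, z] = 0].

Section Projection.
Variables (R : realType) (H : hilbertType R) (M : set H).
Hypotheses (subM : is_subspace M) (clM : closed M).
Implicit Types x y z : H.

Lemma rnorm_ge0 x : 0 <= rnorm x.
Proof. by rewrite -lecR -rnormE normr_ge0. Qed.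

Lemma ler_rnormD x y : rnorm (x + y) <= rnorm x + rnorm y.
Proof. by rewrite -lecR rmorphD /= -!rnormE ler_normD. Qed.

Lemma rparallelogram x y :
  rnorm (x + y) ^+ 2 + rnorm (x - y) ^+ 2 =
  2 * rnorm x ^+ 2 + 2 * rnorm y ^+ 2.
Proof.
apply: (@complexI R); have := parallelogram x y.
by rewrite !(rmorphD, rmorphM, rmorphXn, rmorph_nat) /= -!rnormE.
Qed.

Lemma rnorm_half x : rnorm (2^-1 *: x) = rnorm x / 2.
Proof.
apply: (@complexI R); rewrite -rnormE normrZ rnormE.
rewrite rmorphM /= fmorphV rmorph_nat ger0_norm ?invr_ge0 ?ler0n//.
by rewrite mulrC.
Qed.

Let minimizer_bound (d r : R) : 0 <= d -> 0 < r -> r <= 1 ->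
  8 * d * r + 4 * r ^+ 2 < r * (8 * d + 4 + 1).
Proof. nra. Qed.

Section Minimizer.
Variable x : H.
Let D : set R := [set rnorm (x - z) | z in M].
Let d := inf D.

Let Dinf : has_inf D.
Proof.
split; first by exists (rnorm (x - 0)); exists 0 => //; case: subM.
by exists 0 => _ [z _ <-]; exact: rnorm_ge0.
Qed.

Let d_le z : M z -> d <= rnorm (x - z).
Proof. by move=> Mz; apply: ge_inf; [case: Dinf | exists z]. Qed.

Let d_ge0 : 0 <= d.
Proof. by apply: lb_le_inf; [case: Dinf | move=> _ [z _ <-]; exact: rnorm_ge0]. Qed.

Let d_near e : 0 < e -> exists2 z, M z & rnorm (x - z) < d + e.
Proof. by move=> e0; have [_ [z Mz <-] ze] := inf_adherent e0 Dinf; exists z. Qed.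

Let B (e : R) : set H := [set z | M z /\ rnorm (x - z) < d + e].
Let F := filter_from [set e : R | 0 < e] B.

Let FF : ProperFilter F.
Proof.
apply: filter_from_proper; last first.
  by move=> e /= /d_near[z Mz ze]; exists z.
apply: filter_from_filter; first by exists 1 => /=.
move=> e f /= e0 f0; exists (Num.min e f); first by rewrite /= lt_min e0.
by move=> z [Mz]; rewrite -ltrBlDl lt_min !ltrBlDl => /andP[ze zf].
Qed.

Let FFF : Filter F.
Proof. by case: FF. Qed.

Let close z w e : 0 < e -> B e z -> B e w ->
  rnorm (z - w) ^+ 2 <= 8 * d * e + 4 * e ^+ 2.
Proof.
move=> e0 [Mz ze] [Mw we].
have Mm : M (2^-1 *: (z + w)).
  rewrite scalerDr; case: subM => M0 MM; apply: (MM _ z) => //.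
  by rewrite -[_ *: w]addr0; apply: MM.
have := rparallelogram (x - z) (x - w).
rewrite (_ : x - z - (x - w) = - (z - w)); last first.
  by rewrite !opprB addrC addrA subrK.
rewrite (_ : x - z + (x - w) = 2 *: (x - 2^-1 *: (z + w))); last first.
  rewrite scalerBr scalerA mulfV ?pnatr_eq0// scale1r opprD scaler_nat mulr2n.
  by rewrite addrACA.
rewrite (_ : rnorm (- (z - w)) = rnorm (z - w)); last first.
  by rewrite /rnorm normrN.
have := rnorm_half (2 *: (x - 2^-1 *: (z + w))).
rewrite scalerA mulVf ?pnatr_eq0// scale1r.
have := d_le Mm.
move: (rnorm_ge0 (x - z)) (rnorm_ge0 (x - w)) ze we d_ge0 e0.
move: (rnorm _) (rnorm _) (rnorm _) (rnorm _) (rnorm _) d.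
move=> a b c f g k; nra.
Qed.

Lemma minimizer : exists2 y, M y & forall z, M z -> rnorm (x - y) <= rnorm (x - z).
Proof.
have cF : cvg F.
  apply: (@cauchy_cvg _ F FF); apply: (proj1 (@cauchy_ballP _ H F FFF)) => e e0.
  have [k ek] : exists k : R, e = k%:C.
    by apply/complex_realP/gtr0_real.
  have k0 : 0 < k by rewrite -ltcR -ek.
  pose q := 8 * d + 4 + 1.
  have q0 : 0 < q by rewrite /q; have := d_ge0; lra.
  pose r := Num.min 1 (k ^+ 2 / q).
  have r0 : 0 < r by rewrite /r lt_min ltr01 divr_gt0 ?exprn_gt0.
  have r1 : r <= 1 by rewrite /r ge_min lexx.
  have rq : r * q <= k ^+ 2 by rewrite -ler_pdivlMr// /r ge_min lexx orbT.
  have FB : F (B r) by exists r.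
  exists (B r, B r) => // -[z w] [/= Bz Bw].
  rewrite -ball_normE /ball_ /= rnormE ek ltcR -(@ltr_pXn2r _ 2)// ?nnegrE ?rnorm_ge0 ?(ltW k0)//.
  apply: le_lt_trans (close r0 Bz Bw) _.
  apply: lt_le_trans rq; rewrite /q.
  exact: minimizer_bound.
have Fl : F --> lim F := cF.
set y := lim F in Fl.
have My : M y.
  apply: (@closed_cvg _ _ F FF id M) => //.
  by exists 1 => //= z [].
exists y => // z Mz; apply: le_trans (d_le Mz).
apply/ler_addgt0Pr => e e0.
have e20 : 0 < e / 2 by lra.
have Fy : F [set w | `|y - w| < (e / 2)%:C].
  have e2C : 0 < (e / 2)%:C :> R[i] by rewrite -ltcR in e20.
  exact: (proj1 (@cvgrPdist_lt _ H _ F FFF id y) Fl _ e2C).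
have FB : F (B (e / 2)) by exists (e / 2).
have [w [/= yw [Mw we]]] := @filter_ex _ _ FF _ (@filterI _ _ FFF _ _ Fy FB).
rewrite rnormE ltcR in yw.
rewrite (_ : x - y = (x - w) + - (y - w)); last by rewrite opprB addrA subrK.
have := ler_rnormD (x - w) (- (y - w)).
rewrite {3}/rnorm normrN -/(rnorm _).
move: yw we; lra.
Qed.

End Minimizer.

Lemma orth_proj_exists x : exists y, M y /\ forall z, M z -> '[x - y, z] = 0.
Proof.
have [y My ymin] := minimizer x; exists y; split=> // z Mz.
have [->|z0] := eqVneq z 0; first by rewrite linear0r.
set u := x - y; set a := '[u, z].
have zz0 : 0 < '[z, z] by rewrite dnorm_gt0.
pose t := a / '[z, z].
have Myz : M (t *: z + y) by case: subM => _; apply.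
have := ymin _ Myz; rewrite -lecR -!rnormE -/u.
rewrite (_ : x - (t *: z + y) = u - t *: z); last by rewrite opprD addrCA addrC.
rewrite -(@ler_pXn2r _ 2)// ?nnegrE ?normr_ge0// !sqr_normr_inner.
rewrite (dnormB inner u (t *: z)) (dnormZ inner t z) linearZr_LR /= -/a.
have tE : t^* * a = `|a| ^+ 2 / '[z, z].
  rewrite /t rmorphM fmorphV /= (geC0_conj (ltW zz0)) normCKC.
  by rewrite mulrAC.
have tt : `|t| ^+ 2 * '[z, z] = `|a| ^+ 2 / '[z, z].
  rewrite /t normrM exprMn normfV (gtr0_norm zz0) -mulrA; congr (_ * _).
  by rewrite expr2 -mulrA mulVf ?mulr1 ?gt_eqF.
have rE : (`|a| ^+ 2 / '[z, z])^* = `|a| ^+ 2 / '[z, z].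
  by rewrite geC0_conj// divr_ge0 ?exprn_ge0// ltW.
rewrite tE rE tt opprD addrA addrK lerDl oppr_ge0 => le0.
apply/eqP; rewrite -normr_eq0 -sqrf_eq0.
have : `|a| ^+ 2 <= 0 by move: le0; rewrite pmulr_lle0 ?invr_gt0.
by rewrite eq_le => ->; rewrite exprn_ge0.
Qed.

Lemma orth_projP x : M (orth_proj M x) /\ forall z, M z -> '[x - orth_proj M x, z] = 0.
Proof. exact: (xgetPex 0 (orth_proj_exists x)). Qed.

Lemma orth_proj_uniq x y : M y -> (forall z, M z -> '[x - y, z] = 0) -> orth_proj M x = y.
Proof.
move=> My oy; have [Mp op] := orth_projP x.
have Md : M (orth_proj M x - y).
  by rewrite addrC -scaleN1r; case: subM => _; apply.
apply/eqP; rewrite -subr_eq0 -(dnorm_eq0 inner).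
rewrite (_ : '[_, _] = '[x - y, orth_proj M x - y] - '[x - orth_proj M x, orth_proj M x - y]).
  by rewrite oy// op// subrr.
by rewrite -linearBl /= opprB [in RHS]addrC addrA subrK.
Qed.

Lemma orth_proj_linear a x y : orth_proj M (a *: x + y) = a *: orth_proj M x + orth_proj M y.
Proof.
have [[M1 o1] [M2 o2]] := (orth_projP x, orth_projP y).
apply: orth_proj_uniq; first by case: subM => _; apply.
move=> z Mz; rewrite opprD addrACA -scalerBr linearDl /= linearZl_LR /=.
by rewrite o1// o2// mulr0 addr0.
Qed.

Lemma orth_proj_id x : M x -> orth_proj M x = x.
Proof. by move=> Mx; apply: orth_proj_uniq => // z _; rewrite subrr linear0l. Qed.

End Projection.

Section Closure.
Variables (R : realType) (H : hilbertType R).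

Lemma closure_subspace (M : set H) : is_subspace M -> is_subspace (closure M).
Proof.
move=> [M0 MM]; split; first exact: subset_closure.
move=> a x y cx cy B nB.
have /(_ _ _)/= cont : {for (x, y), continuous (fun p : H * H => a *: p.1 + p.2)}.
  by apply: cvgD; [apply: cvgZr; exact: cvg_fst | exact: cvg_snd].
have [[U V] /= [nU nV] UVB] := cont _ nB.
have [u [Mu Uu]] := cx _ nU; have [v [Mv Vv]] := cy _ nV.
by exists (a *: u + v); split; [exact: MM | exact: (UVB (u, v))].
Qed.

Lemma range_subspace (f : {linear H -> H}) : is_subspace (range f).
Proof.
split; first by exists 0 => //; rewrite linear0.
by move=> a _ _ [x _ <-] [y _ <-]; exists (a *: x + y) => //; rewrite linearP.
Qed.

End Closure.

(* A^(1/2): a positive bounded operator whose square is A. *)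
Record sqrtOp (R : realType) (H : hilbertType R) (A : bop H) := SqrtOp {
  sqrt_fun :> bop H;
  sqrt_ge0 : positive_op sqrt_fun;
  sqrt_sqr : forall x : H, sqrt_fun (sqrt_fun x) = A x
}.

Section Selfadjoint.
Variables (R : realType) (H : hilbertType R) (A : bop H).
Hypothesis A_ge0 : positive_op A.

Lemma positive_selfadjoint x y : '[A x, y] = '[x, A y].
Proof.
have real z : '[A z, z] = '[z, A z].
  by rewrite [RHS]inner_conj geC0_conj.
have q (a : R[i]) : a * '[A x, y] + a^* * '[A y, x] = a * '[x, A y] + a^* * '[y, A x].
  have := real (a *: x + y).
  rewrite !linearP /= !linearDl !linearDr /= !linearZl_LR /= !linearZr_LR /=.
  rewrite !real; move: ('[_, _]) ('[_, _]) => c d.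
  move/eqP; rewrite -subr_eq0 => /eqP e0; apply/eqP; rewrite -subr_eq0.
  by apply/eqP; rewrite -[RHS]e0; ring.
have q1 := q 1; have qi := q 'i; rewrite conjCi in qi; rewrite conjC1 in q1.
have i0 : 'i != 0 :> R[i] by exact: neq0Ci.
rewrite !mul1r in q1.
have q2 : '[A x, y] - '[A y, x] = '[x, A y] - '[y, A x].
  by apply: (mulfI i0); rewrite !mulrBr -!mulNr.
rewrite [LHS](_ : _ = (('[A x, y] + '[A y, x]) + ('[A x, y] - '[A y, x])) / 2).
  by rewrite q1 q2; field.
by field.
Qed.

End Selfadjoint.

Section RangeSqrt.
Variables (R : realType) (H : hilbertType R) (A : bop H) (S : sqrtOp A).

Definition sqrt_range : {pred H} := [pred u | u \in range S].

Fact sqrt_range_submod : submod_closed sqrt_range.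
Proof.
have [r0 rM] := range_subspace S.
split; first exact: mem_set.
by move=> a u v /set_mem ru /set_mem rv; apply: mem_set; exact: rM.
Qed.

HB.instance Definition _ :=
  GRing.isSubmodClosed.Build R[i] H sqrt_range sqrt_range_submod.

(* The range of A^(1/2); below it becomes the Hilbert space R(A^(1/2)) for the
   inner product (A^(1/2) x, A^(1/2) y) = <P x, P y>, where P is the orthogonal
   projection onto the closure of R(A), not the inner product of H. *)
Record rangeSqrt := RangeSqrt {
  rangeSqrt_val : H;
  _ : rangeSqrt_val \in sqrt_range
}.

HB.instance Definition _ := [isSub for rangeSqrt_val].
HB.instance Definition _ := [Choice of rangeSqrt by <:].
HB.instance Definition _ := [SubChoice_isSubLmodule of rangeSqrt by <:].

Fact mem_sqrt_range x : S x \in sqrt_range.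
Proof. by apply: mem_set; exists x. Qed.

Definition sqrt_to_range x : rangeSqrt := RangeSqrt (mem_sqrt_range x).

Definition sqrt_preim (u : rangeSqrt) : H :=
  xget 0 [set x | S x = rangeSqrt_val u].

Definition proj_clrange (x : H) : H := orth_proj (closure (range A)) x.

(* Independent of the choice of preimages: see [range_inner_sqrt]. *)
Definition range_inner (u v : rangeSqrt) : R[i] :=
  '[proj_clrange (sqrt_preim u), proj_clrange (sqrt_preim v)].

Let clA : closed (closure (range A)).
Proof. exact: closed_closure. Qed.
Let subA : is_subspace (closure (range A)) :=
  closure_subspace (range_subspace A).

Lemma proj_clrange_linear a x y : proj_clrange (a *: x + y) = a *: proj_clrange x + proj_clrange y.
Proof. exact: orth_proj_linear. Qed.

Lemma sqrt_selfadjoint x y : '[S x, y] = '[x, S y].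
Proof. exact/positive_selfadjoint/sqrt_ge0. Qed.

Lemma sqr_selfadjoint x y : '[A x, y] = '[x, A y].
Proof. by rewrite -!(sqrt_sqr S) !sqrt_selfadjoint. Qed.

Lemma proj_clrange_eq0 x : (proj_clrange x = 0) <-> (S x = 0).
Proof.
have [Pm Po] := orth_projP subA clA x.
split=> x0.
  have Ax : A x = 0.
    apply: inner_eq0P => z; rewrite sqr_selfadjoint -[x]subr0 -x0.
    by apply: Po; apply: subset_closure; exists z.
  by apply/eqP; rewrite -(dnorm_eq0 inner) sqrt_selfadjoint sqrt_sqr Ax linear0r.
have Ax : A x = 0 by rewrite -(sqrt_sqr S) x0 linear0.
set p := proj_clrange x; rewrite -/p -/(proj_clrange x) in Pm Po.
have xp : rnorm x <= rnorm (x - p).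
  apply/ler_addgt0Pr => e e0.
  have e0C : 0 < e%:C :> R[i] by rewrite -ltcR in e0.
  have [_ [[w _ <-]]] := Pm _ (nbhsx_ballx p _ e0C).
  rewrite -ball_normE /ball_ /= rnormE ltcR => pw.
  have xw : rnorm x <= rnorm (x - A w).
    rewrite -lecR -!rnormE -(@ler_pXn2r _ 2)// ?nnegrE ?normr_ge0//.
    have o : '[x, A w] = 0 by rewrite -sqr_selfadjoint Ax linear0l.
    rewrite !sqr_normr_inner (hnormBd o).
    by rewrite lerDl dnorm_ge0.
  apply: le_trans xw _.
  rewrite (_ : x - A w = (x - p) + (p - A w)); last by rewrite addrA subrK.
  by apply: le_trans (ler_rnormD _ _) _; rewrite lerD2l ltW.
have xE : '[x, x] = '[x - p, x - p] + '[p, p].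
  by rewrite -[in LHS](subrK p x) (hnormDd (Po _ Pm)).
apply/eqP; rewrite -(dnorm_eq0 inner) eq_le dnorm_ge0 andbT.
rewrite -(@lerD2l _ '[x - p, x - p]) -xE addr0 -!sqr_normr_inner.
by rewrite ler_pXn2r ?nnegrE ?normr_ge0// !rnormE lecR.
Qed.

Lemma S_preim u : S (sqrt_preim u) = rangeSqrt_val u.
Proof.
case: u => u /= Hu; have [x _ xu] := set_mem Hu.
exact: (@xgetPex _ 0 [set x | S x = u] (ex_intro _ x xu)).
Qed.

Definition range_iso (u : rangeSqrt) : H := proj_clrange (sqrt_preim u).

Lemma proj_clrange_eq x y : (proj_clrange x = proj_clrange y) <-> (S x = S y).
Proof.
split=> /eqP; rewrite -subr_eq0 => /eqP e0; apply/eqP; rewrite -subr_eq0.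
  rewrite -raddfB /=; apply/eqP/proj_clrange_eq0.
  by rewrite addrC -scaleN1r proj_clrange_linear scaleN1r addrC.
rewrite -raddfB /= in e0; move/proj_clrange_eq0: e0.
by rewrite addrC -scaleN1r proj_clrange_linear scaleN1r addrC => /eqP.
Qed.

Lemma range_isoE x u : S x = rangeSqrt_val u -> range_iso u = proj_clrange x.
Proof. by move=> xu; apply/proj_clrange_eq; rewrite S_preim. Qed.

Lemma range_inner_sqrt x y :
  range_inner (sqrt_to_range x) (sqrt_to_range y) = '[proj_clrange x, proj_clrange y].
Proof.
by rewrite /range_inner -!/(range_iso _) (@range_isoE x)// (@range_isoE y).
Qed.

Lemma range_iso_linear a u v :
  range_iso (a *: u + v) = a *: range_iso u + range_iso v.
Proof.
rewrite -proj_clrange_linear; apply: range_isoE.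
by rewrite linearP /= !S_preim.
Qed.

Lemma range_iso_eq0 u : range_iso u = 0 -> u = 0.
Proof.
move=> /proj_clrange_eq0; rewrite S_preim => u0; exact/val_inj.
Qed.

Fact range_inner_herm u v :
  range_inner u v = (-1) ^+ false * (range_inner v u)^*%R.
Proof. by rewrite expr0 mul1r -inner_conj. Qed.

Fact range_inner_linearl v : linear_for *%R (range_inner ^~ v).
Proof.
move=> a u w; rewrite /range_inner -!/(range_iso _) range_iso_linear.
by rewrite linearDl /= linearZl_LR.
Qed.

Fact range_inner_linearr u : linear_for (Num.conj \; *%R) (range_inner u).
Proof.
move=> a v w; rewrite /range_inner -!/(range_iso _) range_iso_linear.
by rewrite linearDr /= linearZr_LR.
Qed.

HB.instance Definition _ := bilinear_isBilinear.Build R[i]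
  rangeSqrt rangeSqrt R[i] *%R (Num.conj \; *%R) range_inner
  (range_inner_linearl, range_inner_linearr).

HB.instance Definition _ := isHermitianSesquilinear.Build R[i]
  rangeSqrt false Num.conj range_inner range_inner_herm.

Fact range_inner_gt0 u : u != 0 -> 0 < range_inner u u.
Proof.
move=> u0; rewrite dnorm_gt0; apply: contra_neq u0; exact: range_iso_eq0.
Qed.

HB.instance Definition _ := isDotProduct.Build R[i]
  rangeSqrt range_inner range_inner_gt0.

Definition range_norm (u : rangeSqrt) : R[i] := sqrtC (range_inner u u).

Let range_normE u : range_norm u = `|range_iso u|.
Proof. by rewrite normr_inner. Qed.

Fact ler_range_normD u v : range_norm (u + v) <= range_norm u + range_norm v.
Proof.
by rewrite !range_normE -[u]scale1r range_iso_linear !scale1r ler_normD.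
Qed.

Fact range_normZ a u : range_norm (a *: u) = `|a| * range_norm u.
Proof.
have iso0 : range_iso 0 = 0.
  by rewrite -(subrr (0 : rangeSqrt)) -scaleN1r addrC range_iso_linear scaleN1r addNr.
by rewrite !range_normE -[a *: u]addr0 range_iso_linear iso0 addr0 normrZ.
Qed.

Fact range_norm0_eq0 u : range_norm u = 0 -> u = 0.
Proof.
by rewrite range_normE => /eqP; rewrite normr_eq0 => /eqP/range_iso_eq0.
Qed.

HB.instance Definition _ := Lmodule_isNormed.Build R[i] rangeSqrt
  ler_range_normD range_normZ range_norm0_eq0.

Let isoB u v : `|u - v| = `|range_iso u - range_iso v|.
Proof.
rewrite -[LHS]/(range_norm (u - v)) range_normE.
by rewrite addrC -scaleN1r range_iso_linear scaleN1r addrC.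
Qed.

Fact rangeSqrt_complete (F : set_system rangeSqrt) :
  ProperFilter F -> cauchy F -> cvg F.
Proof.
move=> PF cF.
have FF : Filter F by case: PF.
have FJ : Filter (range_iso @ F) by exact: fmap_filter.
have PJ : ProperFilter (range_iso @ F) by exact: fmap_proper_filter.
have cJ : cauchy (range_iso @ F).
  apply: (proj1 (@cauchy_ballP _ H _ FJ)) => e e0.
  have [[P Q] /= [FP FQ] PQ] := proj2 (@cauchy_ballP _ _ F FF) cF e e0.
  exists (range_iso @` P, range_iso @` Q) => /=.
    by split; [apply: filterS FP | apply: filterS FQ] => u Pu; exists u.
  move=> [_ _] [/= [u Pu <-] [v Qv <-]]; have := PQ (u, v) (conj Pu Qv).
  by rewrite /= -!ball_normE /ball_ /= isoB.
have Fl : range_iso @ F --> lim (range_iso @ F) := @cauchy_cvg H _ PJ cJ.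
set y := lim _ in Fl.
have cy : closure (range A) y.
  apply: (@closed_cvg _ _ F PF range_iso (closure (range A)) clA _ y Fl).
  by apply: filterE => u; case: (orth_projP subA clA (sqrt_preim u)).
have isoy : range_iso (sqrt_to_range y) = y.
  by rewrite (@range_isoE y)//; exact: orth_proj_id.
apply/cvg_ex; exists (sqrt_to_range y).
apply: (proj2 (@cvgrPdist_lt _ _ _ F FF id _)) => e e0.
have := proj1 (@cvgrPdist_lt _ H _ F FF range_iso y) Fl e e0.
by apply: filterS => u; rewrite /= isoB isoy.
Qed.

HB.instance Definition _ :=
  Uniform_isComplete.Build rangeSqrt rangeSqrt_complete.

Fact rangeSqrt_normE (u : rangeSqrt) : `|u| = sqrtC (range_inner u u).
Proof. by []. Qed.

HB.instance Definition _ :=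
  CompleteNormedModule_isHilbert.Build R rangeSqrt rangeSqrt_normE.

Fact mem_A_range x : A x \in sqrt_range.
Proof. by apply: mem_set; exists (S x) => //; rewrite sqrt_sqr. Qed.

Definition ZA (x : H) : rangeSqrt := RangeSqrt (mem_A_range x).

End RangeSqrt.

Section Notions.
Variables (R : realType) (H : hilbertType R).

Definition separable := exists D : set H, countable D /\ dense D.

Definition lin_indep n (e : 'I_n -> H) :=
  forall c : 'I_n -> R[i], \sum_(i < n) c i *: e i = 0 -> forall i, c i = 0.

Definition dim_ge (n : nat) (M : set H) :=
  exists e : 'I_n -> H, (forall i, M (e i)) /\ lin_indep e.

Definition infinite_dim := forall n, dim_ge n [set: H].

Definition inner_op (A : bop H) (x y : H) : R[i] := '[A x, y].

Definition norm_op (A : bop H) (x : H) : R[i] := sqrtC (inner_op A x x).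

(* Membership of T in B_{A^(1/2)}(H). *)
Definition norm_op_bounded (A T : bop H) :=
  exists2 c : R, 0 < c & forall x, norm_op A (T x) <= c%:C * norm_op A x.

Definition Wq (q : R[i]) (T : bop H) : set R[i] :=
  [set z | exists u v : H,
    [/\ `|u| = 1, `|v| = 1, '[u, v] = q & z = '[T u, v]]].

Definition WqA (q : R[i]) (A T : bop H) : set R[i] :=
  [set z | exists x y : H,
    [/\ norm_op A x = 1, norm_op A y = 1, inner_op A x y = q
      & z = inner_op A (T x) y]].

End Notions.
Arguments separable {R} H.
Arguments infinite_dim {R} H.

(* Main.v *)
Require Import Defs.
From HB Require Import structures.
From mathcomp Require Import all_boot all_order all_algebra.
From mathcomp Require Import sesquilinear complex.
From mathcomp Require Import all_classical all_reals all_analysis.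

Set Implicit Arguments.
Unset Strict Implicit.
Unset Printing Implicit Defensive.

Import Order.TTheory GRing.Theory Num.Theory.
Import numFieldNormedType.Exports.

Local Open Scope classical_set_scope.
Local Open Scope complex_scope.
Local Open Scope ring_scope.

(** Write [S] for [A^(1/2)] and [P] for the projection onto the closure of the
    range of [A].  The map [ZA] pulls the inner product of [R(A^(1/2))] back to
    the semi-inner product defined by [A]: since [A x = S (S x)],
    [(ZA x, ZA y) = <P (S x), P (S y)> = <S x, S y> = <A x, y>], where the middle
    step holds because [S x] already lies in the closure of the range of [A]
    ([proj_clrange_sqrt]).  If [x] and [y] witness a point of [WqA q A T], then
    [ZA x] and [ZA y] therefore witness the same point for [Ttilde], because
    [Ttilde (ZA x) = ZA (T x)]. *)

(** The residual [S x - P (S x)] is killed by [S], because [P] does not change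
    the value of [S]; by self-adjointness it is then orthogonal to [S x].  It is
    also orthogonal to [P (S x)], hence to itself. *)
Lemma proj_clrange_sqrt (R : realType) (H : hilbertType R) (A : bop H)
    (S : sqrtOp A) (x : H) :
  proj_clrange A (S x) = S x.
Proof.
have subA := closure_subspace (range_subspace A).
have clA : closed (closure (range A)) by exact: closed_closure.
have [Mp resid_orth] := orth_projP subA clA (S x).
rewrite -/(proj_clrange A (S x)) in Mp resid_orth.
set p := proj_clrange A (S x) in Mp resid_orth *.
have Sp : S p = S (S x) by apply/proj_clrange_eq; exact: orth_proj_id.
apply/esym/eqP; rewrite -subr_eq0 -(dnorm_eq0 inner).
rewrite [X in X == 0]linearBr /= (resid_orth _ Mp) subr0.
by rewrite -sqrt_selfadjoint linearB /= Sp subrr linear0l.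
Qed.

Lemma inner_ZA (R : realType) (H : hilbertType R) (A : bop H) (S : sqrtOp A)
    (x y : H) :
  '[ZA S x, ZA S y] = inner_op A x y.
Proof.
have ZAE z : ZA S z = sqrt_to_range S (S z).
  by apply/val_inj; rewrite /= sqrt_sqr.
rewrite !ZAE [LHS]range_inner_sqrt !proj_clrange_sqrt.
by rewrite -sqrt_selfadjoint sqrt_sqr.
Qed.

Lemma norm_ZA (R : realType) (H : hilbertType R) (A : bop H) (S : sqrtOp A)
    (x : H) :
  `|ZA S x| = norm_op A x.
Proof. by rewrite normr_inner inner_ZA. Qed.

Theorem theorem2p3 (R : realType) (H : hilbertType R)
    (Hsep : separable H) (Hinf : infinite_dim H)
    (A : bop H) (A_ge0 : positive_op A) (Ahalf : sqrtOp A)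
    (dimA : dim_ge 2 (range A))
    (q : R[i]) (q_le1 : `|q| <= 1)
    (T : bop H) (T_bounded : norm_op_bounded A T)
    (Ttilde : bop (rangeSqrt Ahalf))
    (TtildeP : forall x : H, ZA Ahalf (T x) = Ttilde (ZA Ahalf x)) :
  WqA q A T `<=` Wq q Ttilde.
Proof.
move=> _ [x [y [x1 y1 xyq ->]]].
exists (ZA Ahalf x), (ZA Ahalf y).
by rewrite !norm_ZA -TtildeP !inner_ZA.
Qed.
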